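(* Let $\Omega$ be a domain in $\mathbb{C}^n$ with $A^2(\Omega)\neq\{0\}$ and let $U\subset\Omega$ be a non-empty open set. Then the Schatten $1$-norm (trace) of $T_U$ is given by $$\|T_U\|_{S_1}=\int_U B_\Omega(\zeta,\zeta)\,dV(\zeta),$$ where $B_\Omega$ is the Bergman kernel of $\Omega$.
   Context: A domain is a connected non-empty open set; $dV$ is Lebesgue measure. For an open set $W\subset\mathbb{C}^n$, $A^2(W)$ is the Bergman space: the Hilbert space of holomorphic functions on $W$ square integrable with respect to Lebesgue measure. $R_U:A^2(\Omega)\to A^2(U)$ is the restriction operator $R_Uf=f|_U$ and $T_U=R_U^*R_U:A^2(\Omega)\to A^2(\Omega)$, a positive self-adjoint operator; equivalently $T_Uf=P(\chi_Uf)$ with $P:L^2(\Omega)\to A^2(\Omega)$ the Bergman (orthogonal) projection. The Bergman kernel $B_\Omega:\Omega\times\Omega\to\mathbb{C}$ is the reproducing kernel of $A^2(\Omega)$: $f(z)=\int_\Omega f(w)B_\Omega(z,w)\,dV(w)$ for $f\in A^2(\Omega)$. For a positive operator $T$, $\|T\|_{S_1}\in[0,\infty]$ is its trace $\sum_j\langle Te_j,e_j\rangle$ over any orthonormal basis $\{e_j\}$ of $A^2(\Omega)$ (when $T$ is compact this is the sum of its eigenvalues counted with multiplicity); both sides of the formula may be infinite. *)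

(* Defs.v *)
From HB Require Import structures.
From mathcomp Require Import all_boot all_order all_algebra complex.
From mathcomp Require Import all_classical all_reals all_analysis.
From mathcomp Require Import lra.

Set Implicit Arguments.
Unset Strict Implicit.
Unset Printing Implicit Defensive.

Import Order.TTheory GRing.Theory Num.Theory numFieldNormedType.Exports.

Local Open Scope classical_set_scope.
Local Open Scope ring_scope.

Section cons_measure.
Context d (T : measurableType d) (R : realType).
Variables (m : {sigma_finite_measure set T -> \bar R}) (n : nat).
Variable mu : {sigma_finite_measure set (n.-tuple T) -> \bar R}.

Definition cons_pair (x : T * n.-tuple T) : n.+1.-tuple T :=
  [tuple of x.1 :: x.2].

Lemma measurable_cons_pair : measurable_fun setT cons_pair.
Proof. exact: measurable_cons. Qed.

Definition cons_measure : set (n.+1.-tuple T) -> \bar R :=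
  pushforward (m \x mu)%E cons_pair.

Let cons_measure0 : cons_measure set0 = 0%E.
Proof. by rewrite /cons_measure /pushforward preimage_set0 measure0. Qed.

Let cons_measure_ge0 A : (0 <= cons_measure A)%E.
Proof. by rewrite /cons_measure /pushforward measure_ge0. Qed.

Let cons_measure_semi_sigma_additive : semi_sigma_additive cons_measure.
Proof.
move=> F mF tF mUF; rewrite /cons_measure /pushforward preimage_bigcup.
have mcF k : measurable (cons_pair @^-1` F k).
  by rewrite -[X in measurable X]setTI; exact: measurable_cons_pair.
apply: measure_semi_sigma_additive => //.
- apply/trivIsetP => i j _ _ ij; rewrite -preimage_setI.
  by move/trivIsetP : tF => /(_ _ _ _ _ ij) ->//; rewrite preimage_set0.
- exact: bigcupT_measurable.
Qed.

HB.instance Definition _ := isMeasure.Build _ _ _ cons_measure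
  cons_measure0 cons_measure_ge0 cons_measure_semi_sigma_additive.

Let cons_measure_sigma_finite : sigma_finite setT cons_measure.
Proof.
have /sigma_finiteP[F [FT ndF Foo]] := sigma_finiteT m.
have /sigma_finiteP[G [GT ndG Goo]] := sigma_finiteT mu.
have mht : measurable_fun setT
    (fun t : n.+1.-tuple T => (thead t, [tuple of behead t])).
  apply: measurable_fun_pair; first exact: measurable_tnth.
  exact: measurable_behead.
exists (fun k => (fun t => (thead t, [tuple of behead t])) @^-1`
    (F k `*` G k)).
  rewrite -preimage_bigcup; apply/esym/seteqP; split => // t _ /=.
  have [i _ Fi] : (\bigcup_i F i) (thead t) by rewrite -FT.
  have [j _ Gj] : (\bigcup_i G i) [tuple of behead t] by rewrite -GT.
  exists (maxn i j) => //; split => /=.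
  - by move: Fi; exact/subsetPset/ndF/leq_maxl.
  - by move: Gj; exact/subsetPset/ndG/leq_maxr.
move=> k; have [mF Fk] := Foo k; have [mG Gk] := Goo k; split.
  by rewrite -[X in measurable X]setTI; apply: mht => //; exact: measurableX.
rewrite /cons_measure /pushforward -comp_preimage.
rewrite (_ : _ \o _ = id) ?preimage_id; last first.
  apply/funext => -[x t] /=; rewrite /cons_pair /= theadE.
  by congr (_, _); apply/val_inj.
by rewrite product_measure1E// lte_mul_pinfty// ge0_fin_numE.
Qed.

HB.instance Definition _ := Measure_isSigmaFinite.Build _ _ _ cons_measure
  cons_measure_sigma_finite.

End cons_measure.

(* n-fold product of a sigma-finite measure, on n-tuples. *)
Fixpoint tuple_measure d (T : measurableType d) (R : realType)
    (m : {sigma_finite_measure set T -> \bar R}) (n : nat) :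
    {sigma_finite_measure set (n.-tuple T) -> \bar R} :=
  match n with
  | 0 => \d_([tuple] : 0.-tuple T)
  | n'.+1 => cons_measure m (tuple_measure m n')
  end.

Lemma tuple_measure_box d (T : measurableType d) (R : realType)
    (m : {sigma_finite_measure set T -> \bar R}) n (A : 'I_n -> set T) :
  (forall i, measurable (A i)) ->
  tuple_measure m n [set t | forall i, A i (tnth t i)] =
  (\prod_(i < n) m (A i))%E.
Proof.
elim: n A => [|n IHn] A mA /=.
  by rewrite big_ord0 diracE mem_set// => -[].
rewrite big_ord_recl -IHn//= /cons_measure /pushforward.
rewrite -product_measure1E//; last first.
  rewrite (_ : mkset _ = \bigcap_(i in setT)
    ((@tnth _ T ^~ i) @^-1` A (lift ord0 i))); last first.
    by apply/seteqP; split => t /= h i => [_|]; exact: h.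
  apply: fin_bigcap_measurable => // i _.
  by rewrite -[X in measurable X]setTI; exact: measurable_tnth.
congr product_measure1; apply/seteqP; split => -[x t] /= h.
- by split => [|i]; [exact: (h ord0)|have := h (lift ord0 i); rewrite tnthS].
- by case: h => hx ht i; case: (unliftP ord0 i) => [j|] ->; rewrite ?tnthS.
Qed.

(* The complex numbers as a numClosedFieldType: through this head constant
   vectors and functions over C inherit the C-normed-module structure. *)
Definition cplx (R : realType) : numClosedFieldType := R[i].

(* C^n with its Borel sigma-algebra. *)
Definition cspace (R : realType) (n : nat) :=
  g_sigma_algebraType (@open 'rV[cplx R]_n).

Section lebesgue_measure_Cn.
Context (R : realType) (n : nat).
Local Notation C := (cplx R).

Definition tuple_to_cspace (t : (n + n).-tuple (measurableTypeR R)) :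
    cspace R n :=
  \row_i (Complex (tnth t (lshift n i)) (tnth t (rshift n i)) : C).

Let box (q : {ffun 'I_n -> rat * rat}) (k : nat) : set 'rV[C]_n :=
  [set v | forall i,
     `|complex.Re (v ord0 i) - ratr (q i).1| < k.+1%:R^-1 /\
     `|complex.Im (v ord0 i) - ratr (q i).2| < k.+1%:R^-1].

Let measurable_box q k : measurable (tuple_to_cspace @^-1` box q k).
Proof.
rewrite (_ : _ @^-1` _ = \bigcap_(i in setT)
   ((@tnth _ (measurableTypeR R) ^~ (lshift n i)) @^-1`
      (ball (ratr (q i).1 : R) k.+1%:R^-1) `&`
    (@tnth _ (measurableTypeR R) ^~ (rshift n i)) @^-1`
      (ball (ratr (q i).2 : R) k.+1%:R^-1))).
  apply: fin_bigcap_measurable => // i _; apply: measurableI;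
    rewrite -[X in measurable X]setTI; apply: measurable_tnth => //;
    by rewrite ball_itv; exact: measurable_itv.
apply/seteqP; split => t /= h i.
- by move=> _; have := h i; rewrite mxE /ball/= ![`|ratr _ - _|]distrC.
- by have := h i I; rewrite mxE /ball/= ![`|ratr _ - _|]distrC.
Qed.

Let rat_approx (x e : R) : 0 < e -> exists q : rat, `|x - ratr q| < e.
Proof.
move=> e0; have /rat_in_itvoo[q] : x - e < x + e by lra.
by rewrite in_itv/= => /andP[h1 h2]; exists q; rewrite ltr_distlC; lra.
Qed.

Let near_approx (x y b d e : R) :
  `|x - b| < d -> `|y - b| < d -> d < e / 4 -> `|x - y| < e / 2.
Proof. by rewrite !ltr_norml => /andP[? ?] /andP[? ?] ?; apply/andP; split; lra. Qed.

Let sqr_lt (x e : R) : `|x| < e / 2 -> x ^+ 2 < e ^+ 2 / 4.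
Proof. by rewrite ltr_norml => /andP[? ?]; nra. Qed.

Let box_sub (A : set 'rV[C]_n) v : open A -> A v ->
  exists q k, box q k v /\ box q k `<=` A.
Proof.
move=> oA Av; have /nbhs_ballP[e /= e0 eA] := open_nbhs_nbhs (conj oA Av).
have Re0 : 0 < complex.Re e.
  by move: e0; rewrite ltcE /= => /andP[].
have eE : e = (complex.Re e)%:C%C.
  by apply/esym/RRe_real; exact: gtr0_real.
have [k] : exists k, 0 + k.+1%:R^-1 < complex.Re e / 4.
  by apply/ltr_add_invr; lra.
rewrite add0r => ke.
have k0 : 0 < k.+1%:R^-1 :> R by rewrite invr_gt0.
have qP i := cid (rat_approx (complex.Re (v ord0 i)) k0).
have pP i := cid (rat_approx (complex.Im (v ord0 i)) k0).
exists [ffun i => (sval (qP i), sval (pP i))], k; split.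
  by move=> i; rewrite ffunE /=; split; [exact: svalP (qP i)|exact: svalP (pP i)].
move=> w bw; apply: eA; split => // i j; rewrite (ord1 i).
have := bw j; rewrite ffunE /= => -[].
have := svalP (qP j); have := svalP (pP j).
set a := ratr _; set b := ratr _; rewrite /ball /= => h1 h2 h3 h4.
rewrite eE; set z := _ - _.
have -> : `|z| = (Num.sqrt (complex.Re z ^+ 2 + complex.Im z ^+ 2))%:C%C.
  exact: normc_def.
have ReB (x y : C) : complex.Re (x - y) = complex.Re x - complex.Re y.
  by case: x y => [? ?] [? ?].
have ImB (x y : C) : complex.Im (x - y) = complex.Im x - complex.Im y.
  by case: x y => [? ?] [? ?].
have zre : `|complex.Re z| < complex.Re e / 2.
  by rewrite /z ReB; exact: near_approx h2 h3 ke.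
have zim : `|complex.Im z| < complex.Re e / 2.
  by rewrite /z ImB; exact: near_approx h1 h4 ke.
rewrite ltcR -(@ger0_norm _ (complex.Re e)) ?ltW// -sqrtr_sqr ltr_sqrt ?exprn_gt0//.
by have := sqr_lt zre; have := sqr_lt zim; have := sqr_ge0 (complex.Re e); lra.
Qed.

Lemma measurable_tuple_to_cspace : measurable_fun setT tuple_to_cspace.
Proof.
apply: (@measurability _ _ ((n + n).-tuple (measurableTypeR R)) (cspace R n)
  setT tuple_to_cspace (@open 'rV[C]_n)) => //.
move=> _ [A oA <-]; rewrite setTI.
rewrite (_ : _ @^-1` _ = \bigcup_(p : {ffun 'I_n -> rat * rat} * nat)
  if `[< box p.1 p.2 `<=` A >] then tuple_to_cspace @^-1` box p.1 p.2
  else set0).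
  apply: countable_bigcupT_measurable => // -[q k] /=.
  by case: ifP => // _; exact: measurable_box.
apply/seteqP; split => t.
- move=> /(box_sub oA)[q [k [bt bA]]]; exists (q, k) => //=.
  by case: asboolP.
- by case=> -[q k] _ /=; case: asboolP => // bA /bA.
Qed.

(* Lebesgue measure on C^n = R^n + i R^n. *)
Definition lebesgue_cspace : set (cspace R n) -> \bar R :=
  pushforward (tuple_measure (@lebesgue_measure R) (n + n)) tuple_to_cspace.

Let lebesgue_cspace0 : lebesgue_cspace set0 = 0%E.
Proof. by rewrite /lebesgue_cspace /pushforward preimage_set0 measure0. Qed.

Let lebesgue_cspace_ge0 A : (0 <= lebesgue_cspace A)%E.
Proof. by rewrite /lebesgue_cspace /pushforward measure_ge0. Qed.

Let lebesgue_cspace_semi_sigma_additive : semi_sigma_additive lebesgue_cspace.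
Proof.
move=> F mF tF mUF; rewrite /lebesgue_cspace /pushforward preimage_bigcup.
have mcF k : measurable (tuple_to_cspace @^-1` F k).
  by rewrite -[X in measurable X]setTI; exact: measurable_tuple_to_cspace.
apply: measure_semi_sigma_additive => //.
- apply/trivIsetP => i j _ _ ij; rewrite -preimage_setI.
  by move/trivIsetP : tF => /(_ _ _ _ _ ij) ->//; rewrite preimage_set0.
- exact: bigcupT_measurable.
Qed.

HB.instance Definition _ := isMeasure.Build _ _ _ lebesgue_cspace
  lebesgue_cspace0 lebesgue_cspace_ge0 lebesgue_cspace_semi_sigma_additive.

End lebesgue_measure_Cn.

Section bergman.
Context (R : realType) (n : nat).
Local Notation C := (cplx R).
Local Notation V := 'rV[cplx R]_n.
Local Notation dV := (@lebesgue_cspace R n).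
Implicit Types (W X : set V) (f g : V -> C).

Definition is_domain W := [/\ open W, connected W & W !=set0].

(* Meaningful for open W: each point of W is then interior to W. *)
Definition holomorphic W f := forall z, W z -> differentiable f z.

Definition cintegral W f : C :=
  Complex (\int[dV]_(z in W) complex.Re (f z))
          (\int[dV]_(z in W) complex.Im (f z)).

(* A function on W is represented by its extension by 0 to C^n, so that
   equality in A2 W is equality of functions. *)
Definition A2 W : set (V -> C) :=
  [set f | [/\ forall z, ~ W z -> f z = 0, holomorphic W f &
    (\int[dV]_(z in W) (complex.Re `|f z| ^+ 2)%:E < +oo)%E]].

Definition dotA2 W f g : C := cintegral W (fun z => f z * (g z)^*).

Definition normA2 W f : R := Num.sqrt (complex.Re (dotA2 W f f)).

Definition restriction W : (V -> C) -> (V -> C) := patch (fun=> 0) W.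

(* S : A2 X -> A2 W is the Hilbert space adjoint of T : A2 W -> A2 X. *)
Definition is_adjoint W X (T S : (V -> C) -> (V -> C)) :=
  (forall g, A2 X g -> A2 W (S g)) /\
  (forall f g, A2 W f -> A2 X g -> dotA2 X (T f) g = dotA2 W f (S g)).

(* The values of B outside W * W are irrelevant. *)
Definition is_bergman_kernel W (B : V -> V -> C) :=
  forall z, W z ->
    A2 W (restriction W (fun w => (B z w)^*)) /\
    (forall f, A2 W f -> f z = cintegral W (fun w => f w * B z w)).

(* Orthonormal family with dense linear span. The index type is arbitrary as
   A2 W may be finite dimensional. *)
Definition is_orthonormal_basis W (I : choiceType) (e : I -> V -> C) :=
  [/\ forall i, A2 W (e i),
      forall i j, dotA2 W (e i) (e j) = (i == j)%:R &
      forall f, A2 W f -> forall eps : R, 0 < eps ->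
        exists (s : seq I) (c : I -> C),
          normA2 W (fun z => f z - \sum_(i <- s) c i * e i z) < eps].

(* For a positive operator T each <T e_i, e_i> is a nonnegative real, so that
   taking real parts loses nothing. *)
Definition trace W (I : choiceType) (e : I -> V -> C)
    (T : (V -> C) -> (V -> C)) : \bar R :=
  \esum_(i in [set: I]) (complex.Re (dotA2 W (T (e i)) (e i)))%:E.

End bergman.

(* Main.v *)
Require Import Defs.
From mathcomp Require Import all_boot all_order all_algebra complex.
From mathcomp Require Import all_classical all_reals all_analysis.
From mathcomp Require Import measurable_realfun ring lra.

Set Implicit Arguments.
Unset Strict Implicit.

Import Order.TTheory GRing.Theory Num.Theory.
Import numFieldNormedType.Exports.

Local Open Scope classical_set_scope.
Local Open Scope ring_scope.

(* By adjointness <T_U e_i, e_i> is the integral of |e_i|^2 over U.  Writing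
   K_z for the conjugate of B(z, -), the reproducing property gives
   e_i(z) = <e_i, K_z> and B(z, z) = |K_z|^2, so Parseval's identity yields
   sum_i |e_i(z)|^2 = B(z, z), and Tonelli exchanges sum and integral.  For the
   exchange the index type has to be countable, which is proved through the
   values of the basis at the rational points of Omega. *)

(** * Bessel's inequality and best approximation for an abstract Hermitian form *)

Section orthonormal_families.
(** The laws of [D] are assumed on [P] only, because a form given by integrals, such as [dotA2], is
    linear only where the integrals converge. *)
Context (C : numClosedFieldType) (E : lmodType C) (P : set E) (D : E -> E -> C).
Hypotheses (P0 : P 0) (PL : forall a u v, P u -> P v -> P (a *: u + v)).
Hypothesis DL : forall a u v w, P u -> P v -> P w ->
  D (a *: u + v) w = a * D u w + D v w.
Hypothesis DC : forall u v, P u -> P v -> D v u = (D u v)^*.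
Hypothesis D_ge0 : forall u, P u -> 0 <= D u u.
Context (I : eqType) (e : I -> E).
Hypotheses (Pe : forall i, P (e i))
  (De : forall i j, D (e i) (e j) = (i == j)%:R).

Let PB u v : P u -> P v -> P (u - v).
Proof. by move=> Pu Pv; rewrite addrC -scaleN1r; exact: PL. Qed.

Let dotDl u v w : P u -> P v -> P w -> D (u + v) w = D u w + D v w.
Proof. by move=> Pu Pv Pw; rewrite -[u]scale1r DL// mul1r scale1r. Qed.

Let dotBl u v w : P u -> P v -> P w -> D (u - v) w = D u w - D v w.
Proof.
by move=> Pu Pv Pw; rewrite addrC -scaleN1r DL// mulN1r addrC.
Qed.

Let dot0l w : P w -> D 0 w = 0.
Proof. by move=> Pw; rewrite -[0 in LHS](subrr 0) dotBl// subrr. Qed.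

Let Psum (s : seq I) (c : I -> C) : P (\sum_(i <- s) c i *: e i).
Proof. by elim/big_rec: _ => // i x _; exact: PL. Qed.

Let dot_suml (s : seq I) (c : I -> C) w : P w ->
  D (\sum_(i <- s) c i *: e i) w = \sum_(i <- s) c i * D (e i) w.
Proof.
move=> Pw; elim: s => [|i s IHs]; first by rewrite !big_nil dot0l.
by rewrite !big_cons DL ?IHs.
Qed.

#[local] Hint Resolve Pe Psum : core.

(** For duplicate-free [s] this is the component of [f] orthogonal to the span of the [e i] with [i]
    in [s]. *)
Let residue f (s : seq I) := f - \sum_(i <- s) D f (e i) *: e i.

Let Presidue f s : P f -> P (residue f s).
Proof. by move=> Pf; exact: PB. Qed.

Let dot_residue f s j : P f -> uniq s -> j \in s -> D (e j) (residue f s) = 0.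
Proof.
move=> Pf us js; rewrite (DC (Presidue s Pf) (Pe j)) /residue dotBl//.
rewrite dot_suml// (bigD1_seq j)//= De eqxx mulr1 big1 ?addr0 ?subrr ?conjC0//.
by move=> i /negbTE ij; rewrite De ij mulr0.
Qed.

Let dot_span_residue f s t (c : I -> C) : P f -> uniq s -> {subset t <= s} ->
  D (\sum_(i <- t) c i *: e i) (residue f s) = 0.
Proof.
move=> Pf us ts; rewrite (dot_suml _ _ (Presidue s Pf)).
by apply: big1_seq => i /= it; rewrite dot_residue ?mulr0// ts.
Qed.

(** Pythagoras: the residue is orthogonal to the sum subtracted from [f], so its square equals
    [D f (residue f s)], and expanding the residue there gives the right-hand side. *)
Lemma dot_residueE f s : P f -> uniq s ->
  D (residue f s) (residue f s) = D f f - \sum_(i <- s) `|D f (e i)| ^+ 2.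
Proof.
move=> Pf us; have Pr := Presidue s Pf.
rewrite {1}/residue dotBl// dot_span_residue// subr0 (DC Pr Pf).
rewrite /residue dotBl//.
rewrite dot_suml// rmorphB /= -(DC Pf Pf); congr (_ - _).
rewrite rmorph_sum; apply: eq_bigr => i _.
by rewrite rmorphM /= -(DC (Pe i) Pf) normCK mulrC.
Qed.

Lemma bessel f s : P f -> uniq s ->
  \sum_(i <- s) `|D f (e i)| ^+ 2 <= D f f.
Proof.
move=> Pf us; rewrite -subr_ge0 -dot_residueE//.
exact: D_ge0 (Presidue s Pf).
Qed.

(** Among combinations of the [e i] with [i] in [s], the orthogonal projection of [f] leaves the
    smallest error. Repetitions are allowed in [t], as in the density clause of
    [is_orthonormal_basis]. *)
Lemma best_approximation f s t (c : I -> C) : P f -> uniq s ->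
  {subset t <= s} ->
  D f f <= \sum_(i <- s) `|D f (e i)| ^+ 2 +
    D (f - \sum_(i <- t) c i *: e i) (f - \sum_(i <- t) c i *: e i).
Proof.
move=> Pf us ts; rewrite -lerBlDl -dot_residueE//.
(* [r] is the gap between the projection and the given combination. It lies in the span attached to
   [s], hence is orthogonal to the residue, and the cross terms below vanish. *)
pose r := \sum_(i <- s) D f (e i) *: e i - \sum_(i <- t) c i *: e i.
have Pp := Presidue s Pf; have Pr : P r by exact: PB.
have rp : D r (residue f s) = 0 by rewrite dotBl// !dot_span_residue// subrr.
have pr : D (residue f s) r = 0 by rewrite (DC Pr Pp) rp conjC0.
have -> : f - \sum_(i <- t) c i *: e i = residue f s + r by rewrite addrA subrK.
move: (residue f s) r Pp Pr rp pr => p r Pp Pr rp pr.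
have Ppr : P (p + r) by rewrite -[p]scale1r; exact: PL.
rewrite dotDl// (DC Ppr Pp) (DC Ppr Pr) !dotDl// rp pr addr0 add0r -!DC//.
by rewrite lerDl D_ge0.
Qed.

End orthonormal_families.

(** * Real and imaginary parts of complex numbers *)

Section complex_coordinates.
Context (R : realType).
Local Notation C := (cplx R).
Implicit Types x y : C.

Lemma cplx_eqP x y :
  complex.Re x = complex.Re y -> complex.Im x = complex.Im y -> x = y.
Proof. by case: x y => [? ?] [? ?] /= -> ->. Qed.

Lemma cplx_ReD x y : complex.Re (x + y) = complex.Re x + complex.Re y.
Proof. by case: x y => [? ?] [? ?]. Qed.

Lemma cplx_ImD x y : complex.Im (x + y) = complex.Im x + complex.Im y.
Proof. by case: x y => [? ?] [? ?]. Qed.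

Lemma cplx_ReN x : complex.Re (- x) = - complex.Re x.
Proof. by case: x. Qed.

Lemma cplx_ImN x : complex.Im (- x) = - complex.Im x.
Proof. by case: x. Qed.

Lemma cplx_ReM x y : complex.Re (x * y) =
  complex.Re x * complex.Re y - complex.Im x * complex.Im y.
Proof. by case: x y => [? ?] [? ?]. Qed.

Lemma cplx_ImM x y : complex.Im (x * y) =
  complex.Re x * complex.Im y + complex.Im x * complex.Re y.
Proof. by case: x y => [? ?] [? ?]. Qed.

Lemma cplx_ReJ x : complex.Re x^* = complex.Re x.
Proof. by case: x. Qed.

Lemma cplx_ImJ x : complex.Im x^* = - complex.Im x.
Proof. by case: x. Qed.

Definition cplxE := (cplx_ReD, cplx_ImD, cplx_ReN, cplx_ImN, cplx_ReM, cplx_ImM,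
  cplx_ReJ, cplx_ImJ).

Lemma cplx_normE x :
  `|x| = (Num.sqrt (complex.Re x ^+ 2 + complex.Im x ^+ 2))%:C%C :> C.
Proof. exact: normc_def. Qed.

Lemma cplx_sqr_norm x :
  complex.Re `|x| ^+ 2 = complex.Re x ^+ 2 + complex.Im x ^+ 2.
Proof. by rewrite cplx_normE/= sqr_sqrtr// addr_ge0 ?sqr_ge0. Qed.

Lemma cplx_Re_sqr_norm x :
  complex.Re (`|x| ^+ 2) = complex.Re x ^+ 2 + complex.Im x ^+ 2.
Proof.
by rewrite -cplx_sqr_norm cplx_normE expr2 cplx_ReM/= mulr0 subr0 expr2.
Qed.

Lemma cplx_ge0 x : 0 <= complex.Re x -> complex.Im x = 0 -> 0 <= x.
Proof. by case: x => a b /= a0 ->; rewrite lecE /= eqxx. Qed.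

Lemma cplx_leRe x y : x <= y -> complex.Re x <= complex.Re y.
Proof. by rewrite lecE => /andP[]. Qed.

Lemma cplx_Re_le_norm x : `|complex.Re x| <= complex.Re `|x|.
Proof.
by rewrite cplx_normE/= -sqrtr_sqr ler_wsqrtr// lerDl sqr_ge0.
Qed.

Lemma cplx_Im_le_norm x : `|complex.Im x| <= complex.Re `|x|.
Proof.
by rewrite cplx_normE/= -sqrtr_sqr ler_wsqrtr// lerDr sqr_ge0.
Qed.

Lemma cplx_sum_Re (I : Type) (s : seq I) (F : I -> C) :
  complex.Re (\sum_(i <- s) F i) = \sum_(i <- s) complex.Re (F i).
Proof.
elim: s => [|i s IHs]; first by rewrite !big_nil.
by rewrite !big_cons cplx_ReD IHs.
Qed.

Lemma cplx_continuous_Re (T : topologicalType) (f : T -> C) (z : T) :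
  {for z, continuous f} -> {for z, continuous (fun w => complex.Re (f w))}.
Proof.
move=> /cvgrPdist_lt cf; apply/cvgrPdist_lt => e e0.
(* The norm of [C] takes its values in [C], so the real tolerance has to be supplied as a complex
   number. *)
have e0C : 0 < e%:C%C :> C by rewrite ltcR.
apply: filterS (cf _ e0C) => w; rewrite ltcE/= => /andP[_].
by apply: le_lt_trans; rewrite -cplx_ReN -cplx_ReD cplx_Re_le_norm.
Qed.

Lemma cplx_continuous_Im (T : topologicalType) (f : T -> C) (z : T) :
  {for z, continuous f} -> {for z, continuous (fun w => complex.Im (f w))}.
Proof.
move=> /cvgrPdist_lt cf; apply/cvgrPdist_lt => e e0.
have e0C : 0 < e%:C%C :> C by rewrite ltcR.
apply: filterS (cf _ e0C) => w; rewrite ltcE/= => /andP[_].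
by apply: le_lt_trans; rewrite -cplx_ImN -cplx_ImD cplx_Im_le_norm.
Qed.

End complex_coordinates.

(** * Locality of differentiability, and measurability of holomorphic functions *)

Lemma near_eq_differentiable (K : numFieldType) (V W : normedModType K)
    (f g : V -> W) (z : V) : (\near z, f z = g z) ->
  differentiable f z -> differentiable g z.
Proof.
move=> fg /diff_locallyP[df fE]; apply/diff_locallyP.
(* The first-order expansion of [f] at [z] also serves for [g], so uniqueness of the differential
   identifies the two differentials. *)
have gE : g \o shift z = cst (g z) + 'd f z +o_ 0 id.
  apply/eqaddoP => _/posnumP[eps].
  have /eqaddoP/(_ _ (gt0 eps)) := fE.
  have fg0 : \forall h \near (0 : V), f (h + z) = g (h + z).
    move: fg; rewrite (near_shift 0 z).
    by apply: filterS => h /=; rewrite subr0.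
  rewrite -(nbhs_singleton fg); apply: filterS2 fg0 => h /= fgh.
  by rewrite !fctE /= fgh.
have dgE : 'd g z = 'd f z :> (V -> W) by exact: diff_unique.
by rewrite dgE.
Qed.

Section holomorphic_functions.
Context (R : realType) (n : nat).
Local Notation C := (cplx R).
Local Notation V := 'rV[cplx R]_n.
Implicit Types (W : set V) (f g : V -> C).

Lemma measurable_open_cspace W : open W -> measurable (W : set (cspace R n)).
Proof. by move=> oW; exact: sub_gen_smallest. Qed.

(** Open intervals generate the Borel sets of [R], and the part of [W] that [f] sends into one is
    open. *)
Lemma measurable_fun_continuous W (f : V -> R) : open W ->
  (forall z, W z -> {for z, continuous f}) ->
  measurable_fun (W : set (cspace R n)) f.
Proof.
move=> oW cf; apply: (measurability _ (RGenOpens.measurableE R)).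
move=> _ [_ [a [b ->] <-]]; apply: measurable_open_cspace.
rewrite openE => z [Wz fz]; apply: filterI; first exact: open_nbhs_nbhs.
by apply: cf => //; apply: open_nbhs_nbhs; split => //; exact: interval_open.
Qed.

Lemma holomorphic_continuous W f z : holomorphic W f -> W z ->
  {for z, continuous f}.
Proof. by move=> hf Wz; exact/differentiable_continuous/hf. Qed.

Lemma measurable_holomorphic_Re W f : open W -> holomorphic W f ->
  measurable_fun (W : set (cspace R n)) (fun z => complex.Re (f z)).
Proof.
move=> oW hf; apply: measurable_fun_continuous => // z Wz.
exact/cplx_continuous_Re/(holomorphic_continuous hf).
Qed.

Lemma measurable_holomorphic_Im W f : open W -> holomorphic W f ->
  measurable_fun (W : set (cspace R n)) (fun z => complex.Im (f z)).
Proof.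
move=> oW hf; apply: measurable_fun_continuous => // z Wz.
exact/cplx_continuous_Im/(holomorphic_continuous hf).
Qed.

End holomorphic_functions.

(** * The space [A2 W] and its inner product *)

Section bergman_inner_product.
Context (R : realType) (n : nat).
Local Notation C := (cplx R).
Local Notation V := 'rV[cplx R]_n.
Local Notation dV := (@lebesgue_cspace R n).
Implicit Types (W : set V) (f g h : V -> C).

Lemma A2_integrable_sqr W f : open W -> A2 W f ->
  dV.-integrable W (fun z => (complex.Re `|f z| ^+ 2)%:E).
Proof.
move=> oW [_ hf foo]; apply/integrableP; split.
  apply/measurable_EFinP; under eq_fun do rewrite cplx_sqr_norm.
  by apply: measurable_funD; apply: measurable_funX;
    [exact: measurable_holomorphic_Re|exact: measurable_holomorphic_Im].
by under eq_integral do rewrite gee0_abs ?lee_fin ?sqr_ge0//.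
Qed.

(** The integrand is dominated by [|f|^2 + |g|^2], by the arithmetic-geometric mean inequality in
    each coordinate. *)
Lemma A2_integrable_dotRe W f g : open W -> A2 W f -> A2 W g ->
  dV.-integrable W (fun z => (complex.Re (f z * (g z)^*))%:E).
Proof.
move=> oW Af Ag; have mW := measurable_open_cspace oW.
have := integrableD mW (A2_integrable_sqr oW Af) (A2_integrable_sqr oW Ag).
case: Af Ag => _ hf _ [_ hg _].
apply: le_integrable => //.
  apply/measurable_EFinP; under eq_fun do rewrite !cplxE.
  apply: measurable_funB; apply: measurable_funM => //;
    try apply: measurable_funN;
    by [exact: measurable_holomorphic_Re|exact: measurable_holomorphic_Im].
move=> z _; rewrite !cplxE !cplx_sqr_norm lee_fin.
rewrite [leRHS]ger0_norm ?addr_ge0 ?sqr_ge0//.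
set a := complex.Re (f z); set b := complex.Im (f z).
set c := complex.Re (g z); set d := complex.Im (g z).
have := sqr_ge0 (a + c); have := sqr_ge0 (a - c).
have := sqr_ge0 (b + d); have := sqr_ge0 (b - d).
rewrite ler_norml; nra.
Qed.

Lemma A2_integrable_dotIm W f g : open W -> A2 W f -> A2 W g ->
  dV.-integrable W (fun z => (complex.Im (f z * (g z)^*))%:E).
Proof.
move=> oW Af Ag; have mW := measurable_open_cspace oW.
have := integrableD mW (A2_integrable_sqr oW Af) (A2_integrable_sqr oW Ag).
case: Af Ag => _ hf _ [_ hg _].
apply: le_integrable => //.
  apply/measurable_EFinP; under eq_fun do rewrite !cplxE.
  apply: measurable_funD; apply: measurable_funM => //;
    try apply: measurable_funN;
    by [exact: measurable_holomorphic_Re|exact: measurable_holomorphic_Im].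
move=> z _; rewrite !cplxE !cplx_sqr_norm lee_fin.
rewrite [leRHS]ger0_norm ?addr_ge0 ?sqr_ge0//.
set a := complex.Re (f z); set b := complex.Im (f z).
set c := complex.Re (g z); set d := complex.Im (g z).
(* The imaginary part is [b * c - a * d], so the squares now pair [b] with [c] and [a] with [d]. *)
have := sqr_ge0 (b + c); have := sqr_ge0 (b - c).
have := sqr_ge0 (a + d); have := sqr_ge0 (a - d).
rewrite ler_norml; nra.
Qed.

Lemma A2_0 W : A2 W (0 : V -> C).
Proof.
split; [by []|by move=> z Wz; exact: differentiable_cst|].
suff -> : (\int[dV]_(z in W) (complex.Re `|(0 : V -> C) z| ^+ 2)%:E = 0)%E.
  by [].
by apply: integral0_eq => z _; rewrite normr0 expr0n.
Qed.

(** Square integrability follows from [|a f + g|^2 <= 2 |a|^2 |f|^2 + 2 |g|^2]. *)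
Lemma A2_linear W (a : C) f g : open W -> A2 W f -> A2 W g -> A2 W (a *: f + g).
Proof.
move=> oW Af Ag; have mW := measurable_open_cspace oW.
have [f0 hf _] := Af; have [g0 hg _] := Ag.
have hfg : holomorphic W (a *: f + g).
  move=> z Wz; apply: differentiableD; last exact: hg.
  by apply: differentiableZ; exact: hf.
split => //; first by move=> z Wz; rewrite !fctE /= f0// g0// scaler0 addr0.
have iS := integrableD mW
  (integrableZl mW (2 * complex.Re `|a| ^+ 2) (A2_integrable_sqr oW Af))
  (integrableZl mW 2 (A2_integrable_sqr oW Ag)).
apply: le_lt_trans (integrable_lty mW iS); apply: ge0_le_integral => //.
- by move=> z _; rewrite lee_fin sqr_ge0.
- apply/measurable_EFinP; under eq_fun do rewrite cplx_sqr_norm.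
  by apply: measurable_funD; apply: measurable_funX;
    [exact: measurable_holomorphic_Re|exact: measurable_holomorphic_Im].
- exact: measurable_int iS.
move=> z _; rewrite /= lee_fin !fctE /= !cplx_sqr_norm.
rewrite -[a *: f z]/(a * f z) !cplxE.
set s := complex.Re a; set t := complex.Im a.
set u := complex.Re (f z); set v := complex.Im (f z).
set p := complex.Re (g z); set q := complex.Im (g z).
rewrite -subr_ge0.
(* Parallelogram law: the slack in the bound is exactly [|a f - g|^2]. *)
have -> : 2 * (s ^+ 2 + t ^+ 2) * (u ^+ 2 + v ^+ 2) + 2 * (p ^+ 2 + q ^+ 2) -
    ((s * u - t * v + p) ^+ 2 + (s * v + t * u + q) ^+ 2) =
    (s * u - t * v - p) ^+ 2 + (s * v + t * u - q) ^+ 2 by ring.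
by rewrite addr_ge0 ?sqr_ge0.
Qed.

Lemma dotA2_linear W (a : C) f g h : open W -> A2 W f -> A2 W g -> A2 W h ->
  dotA2 W (a *: f + g) h = a * dotA2 W f h + dotA2 W g h.
Proof.
move=> oW Af Ag Ah; have mW := measurable_open_cspace oW.
have ifR := A2_integrable_dotRe oW Af Ah.
have ifI := A2_integrable_dotIm oW Af Ah.
have igR := A2_integrable_dotRe oW Ag Ah.
have igI := A2_integrable_dotIm oW Ag Ah.
have iZ (c : R) k : dV.-integrable W (fun z => (k z)%:E) ->
    dV.-integrable W (fun z => (c * k z)%:E).
  by move=> ik; exact: (integrableZl mW c ik).
have iD k k' : dV.-integrable W (fun z => (k z)%:E) ->
    dV.-integrable W (fun z => (k' z)%:E) ->
    dV.-integrable W (fun z => (k z + k' z)%:E).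
  by move=> ik ik'; exact: (integrableD mW ik ik').
have fE z : (a *: f + g) z * (h z)^* = a * (f z * (h z)^*) + g z * (h z)^*.
  by rewrite fctE /= -[(a *: f) z]/(a * f z) mulrDl mulrA.
apply: cplx_eqP; rewrite /dotA2 /cintegral
  ?cplx_ReD ?cplx_ReM ?cplx_ImD ?cplx_ImM /=.
  under eq_Rintegral do rewrite fE cplx_ReD cplx_ReM -mulNr.
  rewrite RintegralD//; [|by apply: iD; exact: iZ].
  by rewrite RintegralD// ?RintegralZl// ?mulNr//; exact: iZ.
under eq_Rintegral do rewrite fE cplx_ImD cplx_ImM.
rewrite RintegralD//; [|by apply: iD; exact: iZ].
by rewrite RintegralD// ?RintegralZl//; exact: iZ.
Qed.

Lemma dotA2C W f g : open W -> A2 W f -> A2 W g ->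
  dotA2 W g f = (dotA2 W f g)^*.
Proof.
move=> oW Af Ag; apply: cplx_eqP; rewrite !cplxE /=.
  by apply: eq_Rintegral => z _; rewrite !cplxE; ring.
rewrite -mulN1r -RintegralZl; [|exact: measurable_open_cspace|].
  by apply: eq_Rintegral => z _; rewrite !cplxE; ring.
exact: A2_integrable_dotIm.
Qed.

Lemma Re_dotA2xx W f :
  complex.Re (dotA2 W f f) = \int[dV]_(z in W) (complex.Re `|f z| ^+ 2).
Proof.
by apply: eq_Rintegral => z _; rewrite cplx_sqr_norm !cplxE; ring.
Qed.

Lemma dotA2xx_ge0 W f : 0 <= dotA2 W f f.
Proof.
apply: cplx_ge0; last first.
  rewrite /= /Rintegral integral0_eq// => z _.
  by congr EFin; rewrite !cplxE; ring.
by rewrite Re_dotA2xx; apply: Rintegral_ge0 => z _; exact: sqr_ge0.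
Qed.

(** [dotA2] is built from [Rintegral], which reads an infinite integral as 0. Membership in [A2 W]
    excludes that case. *)
Lemma EFin_Re_dotA2xx W f : open W -> A2 W f ->
  (complex.Re (dotA2 W f f))%:E =
  (\int[dV]_(z in W) (complex.Re `|f z| ^+ 2)%:E)%E.
Proof.
move=> oW Af; rewrite Re_dotA2xx /Rintegral fineK//.
by apply: integrable_fin_num;
  [exact: measurable_open_cspace|exact: A2_integrable_sqr].
Qed.

Lemma A2_restriction W U f : open W -> open U -> U `<=` W -> A2 W f ->
  A2 U (restriction U f).
Proof.
move=> oW oU UW Af; have [_ hf foo] := Af; split.
- by move=> z Uz; rewrite /restriction patchE memNset.
- move=> z Uz; apply: near_eq_differentiable (hf _ (UW _ Uz)).
  have : \near z, U z by exact: open_nbhs_nbhs.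
  by apply: filterS => w Uw; rewrite /restriction patchE mem_set.
have rE z : U z -> restriction U f z = f z.
  by move=> Uz; rewrite /restriction patchE mem_set.
under eq_integral => z /set_mem Uz do rewrite rE//.
apply: le_lt_trans foo; apply: ge0_subset_integral => //.
- exact: measurable_open_cspace.
- exact: measurable_open_cspace.
- by have /measurable_int := A2_integrable_sqr oW Af.
- by move=> z _; rewrite lee_fin sqr_ge0.
Qed.

End bergman_inner_product.

(** * Unordered sums of nonnegative terms, and their exchange with integrals *)

Section sums_over_arbitrary_types.
Context (R : realType) (I : choiceType).

(** Passes from the finite sets in the supremum defining [esum] to the duplicate-free sequences of
    Bessel's inequality. *)
Lemma finite_set_uniq_seq (A : set I) : finite_set A ->
  exists2 s : seq I, uniq s & A = [set` s].
Proof.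
move=> fA; exists (finmap.enum_fset (fset_set A)).
  exact: finmap.fset_uniq.
by rewrite -[LHS]fset_setK//; apply/seteqP; split.
Qed.

Lemma esum_EFin_le (a : I -> R) (M : R) :
  (forall s, uniq s -> \sum_(i <- s) a i <= M) ->
  (\esum_(i in [set: I]) (a i)%:E <= M%:E)%E.
Proof.
move=> aM; apply: ge_ereal_sup => _ [A [fA _] <-].
have [s us ->] := finite_set_uniq_seq fA.
by rewrite -fsbig_seq// sumEFin lee_fin aM.
Qed.

Lemma esum_EFin_ge (a : I -> R) (s : seq I) : uniq s ->
  ((\sum_(i <- s) a i)%:E <= \esum_(i in [set: I]) (a i)%:E)%E.
Proof.
move=> us; apply: esum_ge; exists [set` s]; last first.
  by rewrite -fsbig_seq// sumEFin.
by split => //; exact: finite_seq.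
Qed.

(** For each [k] only finitely many terms exceed [1 / (k + 1)]: otherwise some [N > M * (k + 1)] of
    them would have a sum above [M]. *)
Lemma countable_support_bounded_sums (a : I -> R) (M : R) :
  (forall i, 0 <= a i) ->
  (forall s, uniq s -> \sum_(i <- s) a i <= M) ->
  countable [set i | a i != 0].
Proof.
move=> a0 aM.
have -> : [set i | a i != 0] = \bigcup_k [set i | k.+1%:R^-1 < a i].
  apply/seteqP; split => [i ai0|i [k _ /= ki]].
    have ai : 0 < a i by rewrite lt_neqAle eq_sym ai0 a0.
    by have [k ki] := ltr_add_invr ai; exists k; rewrite ?add0r// in ki *.
  by rewrite /= gt_eqF// (lt_trans _ ki)// invr_gt0.
apply: bigcup_countable => // k _; apply: finite_set_countable.
apply: contrapT => inf.
have [N MN] : exists N : nat, M < N%:R / k.+1%:R.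
  exists (Num.trunc (M * k.+1%:R)).+1; rewrite ltr_pdivlMr//.
  exact: truncnS_gt.
have [B Bk NB] := infinite_set_fset N inf.
have := aM _ (finmap.fset_uniq B); apply/negP; rewrite -ltNge.
apply: lt_le_trans MN _.
apply: (@le_trans _ _ (\sum_(i <- finmap.enum_fset B) k.+1%:R^-1)).
  rewrite big_const_seq count_predT iter_addr addr0 -[leRHS]mulr_natl.
  by rewrite ler_pM2r ?invr_gt0// ler_nat.
by rewrite big_seq [leRHS]big_seq; apply: ler_sum => i iB; exact/ltW/Bk.
Qed.

(** For injective [g], the partial inverse, with [None] off the range. It pads a sum over [I] with
    zeros into a series over [nat]. *)
Let unindex (g : I -> nat) (k : nat) : option I :=
  if pselect (exists i, g i = k) is left H then Some (sval (cid H)) else None.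

Let unindexK g : injective g -> pcancel g (unindex g).
Proof.
move=> ginj i; rewrite /unindex; case: pselect => [H|[]]; last by exists i.
by congr Some; apply: ginj; exact: svalP (cid H).
Qed.

Let esum_nneseries g (a : I -> \bar R) : injective g ->
  (forall i, 0 <= a i)%E ->
  \esum_(i in [set: I]) a i =
  (\sum_(0 <= k <oo) if unindex g k is Some i then a i else 0)%E.
Proof.
move=> ginj a0; rewrite nneseries_esumT; last by move=> k; case: unindex.
rewrite [RHS](_ : _ =
    \esum_(k in range g) (if unindex g k is Some i then a i else 0%E)).
  rewrite [RHS](reindex_esum setT (range g) g); last first.
    by apply: inj_bij => ? ? _ _; exact: ginj.
  by apply: eq_esum => i _; rewrite unindexK.
(* Off the range of [g] the padded term is 0, so extending the sum to all of [nat] changes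
   nothing. *)
rewrite [RHS]esum_mkcond; apply: eq_esum => k _; case: ifPn => // /negP kg.
rewrite /unindex; case: pselect => // -[i gik]; exfalso; apply: kg.
by rewrite inE; exists i.
Qed.

(** Countability reduces this to the exchange for series. It is essential: the indicators of the
    points of the real line all have Lebesgue integral 0, yet they sum to 1 everywhere. *)
Lemma integral_esum d (T : measurableType d) (mu : {measure set T -> \bar R})
    (D : set T) (F : I -> T -> \bar R) :
  countable [set: I] -> measurable D -> (forall i, measurable_fun D (F i)) ->
  (forall i x, 0 <= F i x)%E ->
  (\int[mu]_(x in D) \esum_(i in [set: I]) F i x)%E =
  \esum_(i in [set: I]) (\int[mu]_(x in D) F i x)%E.
Proof.
move=> /countable_injP[g ginj'] mD mF F0.
have ginj : injective g by move=> i j; apply: ginj'; rewrite inE.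
under eq_integral do rewrite (esum_nneseries ginj)//.
rewrite (esum_nneseries ginj); last by move=> i; exact: integral_ge0.
rewrite integral_nneseries//.
- by apply: eq_eseriesr => k _; case: unindex => //; exact: integral0.
- by move=> k; case: unindex.
- by move=> k x _; case: unindex.
Qed.

End sums_over_arbitrary_types.

(** * A countable dense set of points in complex space *)

Section rational_points.
Context (R : realType) (n : nat).
Local Notation C := (cplx R).
Local Notation V := 'rV[cplx R]_n.

Definition rational_point (q : {ffun 'I_n -> rat * rat}) : V :=
  \row_i (Complex (ratr (q i).1) (ratr (q i).2) : C).

Lemma open_rational_point (A : set V) : open A -> A !=set0 ->
  exists q, A (rational_point q).
Proof.
move=> oA [v Av]; have /nbhs_ballP[e /= e0 eA] := open_nbhs_nbhs (conj oA Av).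
have re0 : 0 < complex.Re e by move: e0; rewrite ltcE => /andP[].
(* The radius of the ball is an element of [C]; being positive, it is real. *)
have eE : e = (complex.Re e)%:C%C by apply/esym/RRe_real; exact: gtr0_real.
have ratP (x : R) : exists q : rat, `|x - ratr q| < complex.Re e / 2.
  (* Errors below half the radius in both real coordinates keep the modulus below the radius, since
     [1/4 + 1/4 < 1]. *)
  have /rat_in_itvoo[q] : x - complex.Re e / 2 < x + complex.Re e / 2 by lra.
  by rewrite in_itv/= => /andP[h1 h2]; exists q; rewrite ltr_distlC; lra.
have qP i := cid (ratP (complex.Re (v ord0 i))).
have pP i := cid (ratP (complex.Im (v ord0 i))).
exists [ffun i => (sval (qP i), sval (pP i))]; apply: eA; split => // i j.
rewrite (ord1 i) mxE ffunE /ball /= [ltRHS]eE.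
have := svalP (qP j); have := svalP (pP j).
set a := ratr _; set b := ratr _.
set z := v ord0 j - _.
have <- : complex.Re z = complex.Re (v ord0 j) - b by rewrite /z !cplxE.
have <- : complex.Im z = complex.Im (v ord0 j) - a by rewrite /z !cplxE.
rewrite !ltr_norml => /andP[h1 h2] /andP[h3 h4].
rewrite cplx_normE ltcR -[ltRHS]ger0_norm ?ltW// -sqrtr_sqr.
rewrite ltr_sqrt ?exprn_gt0//.
move: h1 h2 h3 h4 re0; nra.
Qed.
End rational_points.

(** * Parseval's identity in [A2 W] *)

Section parseval.
Context (R : realType) (n : nat) (W : set 'rV[cplx R]_n) (I : choiceType).
Context (e : I -> 'rV[cplx R]_n -> cplx R).
Hypotheses (oW : open W) (eP : is_orthonormal_basis W e).
Local Notation C := (cplx R).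
Local Notation V := 'rV[cplx R]_n.
Implicit Types (f : V -> C) (s : seq I).

Lemma A2_bessel f s : A2 W f -> uniq s ->
  \sum_(i <- s) complex.Re `|dotA2 W f (e i)| ^+ 2 <=
  complex.Re (dotA2 W f f).
Proof.
case: eP => Ae De _ Af us.
have := @bessel _ _ (A2 W) (@dotA2 R n W) (@A2_0 R n W)
  (fun a u v Pu Pv => @A2_linear R n W a u v oW Pu Pv)
  (fun a u v w Pu Pv Pw => @dotA2_linear R n W a u v w oW Pu Pv Pw)
  (fun u v Pu Pv => @dotA2C R n W u v oW Pu Pv)
  (fun u _ => dotA2xx_ge0 W u) I e Ae De f s Af us.
move/cplx_leRe; rewrite cplx_sum_Re.
by under eq_bigr do rewrite cplx_Re_sqr_norm -cplx_sqr_norm.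
Qed.

(** One inequality is Bessel's. For the other, density gives a combination close to [f], and
    [best_approximation] bounds the square of [f] by a finite Bessel sum plus the squared error. *)
Lemma A2_parseval f : A2 W f ->
  \esum_(i in [set: I]) (complex.Re `|dotA2 W f (e i)| ^+ 2)%:E =
  (complex.Re (dotA2 W f f))%:E.
Proof.
move=> Af; apply/eqP; rewrite eq_le; apply/andP; split.
  by apply: esum_EFin_le => s; exact: A2_bessel.
case: eP => Ae De dense_e.
apply/lee_addgt0Pr => eps eps0.
(* The distance to [f] enters squared, hence the square root. *)
have seps0 : 0 < Num.sqrt eps by rewrite sqrtr_gt0.
have [t [c tc]] := dense_e f Af _ seps0.
(* Density may return repeated indices, while the Bessel sum must count each index once. *)
have ut := undup_uniq t.
have tsub : {subset t <= undup t} by move=> i; rewrite mem_undup.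
apply: le_trans (leeD2r eps%:E (esum_EFin_ge _ ut)); rewrite -EFinD lee_fin.
have := @best_approximation _ _ (A2 W) (@dotA2 R n W) (@A2_0 R n W)
  (fun a u v Pu Pv => @A2_linear R n W a u v oW Pu Pv)
  (fun a u v w Pu Pv Pw => @dotA2_linear R n W a u v w oW Pu Pv Pw)
  (fun u v Pu Pv => @dotA2C R n W u v oW Pu Pv)
  (fun u _ => dotA2xx_ge0 W u) I e Ae De f (undup t) t c Af ut tsub.
move/cplx_leRe; rewrite cplx_ReD cplx_sum_Re.
under eq_bigr do rewrite cplx_Re_sqr_norm -cplx_sqr_norm.
move=> /le_trans; apply; rewrite lerD2l.
have -> : f - \sum_(i <- t) c i *: e i =
    (fun z => f z - \sum_(i <- t) c i * e i z).
  by apply/funext => z; rewrite !fctE /= fct_sumE.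
apply/ltW; move: tc; rewrite /normA2 ltr_sqrt//.
Qed.

(** * The Bergman kernel on the diagonal, and countability of the basis *)

Context (B : V -> V -> C).
Hypothesis BP : is_bergman_kernel W B.

Let K (z : V) : V -> C := restriction W (fun w => (B z w)^*).

Let A2_K z : W z -> A2 W (K z).
Proof. by move=> /BP[]. Qed.

Let reproducing f z : W z -> A2 W f -> f z = dotA2 W f (K z).
Proof.
move=> Wz Af; have [_ /(_ _ Af) ->] := BP Wz.
by apply: cplx_eqP; apply: eq_Rintegral => w Ww;
  rewrite /K /restriction patchE Ww conjCK.
Qed.

(** The reproducing property is applied to [K z] at the point [z]; conjugation leaves the real part
    alone. *)
Let kernel_diag z : W z ->
  complex.Re (B z z) = complex.Re (dotA2 W (K z) (K z)).
Proof.
move=> Wz; rewrite -(reproducing Wz (A2_K Wz)).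
by rewrite /K /restriction patchE mem_set// cplx_ReJ.
Qed.

Let dot_kernel_norm i z : W z ->
  complex.Re `|dotA2 W (K z) (e i)| ^+ 2 = complex.Re `|e i z| ^+ 2.
Proof.
case: eP => Ae _ _ Wz; rewrite (reproducing Wz (Ae i)).
by rewrite (dotA2C oW (A2_K Wz) (Ae i)) norm_conjC.
Qed.

(** This is Parseval's identity for [K z], whose coefficients are the conjugates of the values
    [e i z]. *)
Lemma esum_sqr_norm_basis z : W z ->
  \esum_(i in [set: I]) (complex.Re `|e i z| ^+ 2)%:E = (complex.Re (B z z))%:E.
Proof.
move=> Wz; rewrite kernel_diag// -(A2_parseval (A2_K Wz)).
by apply: eq_esum => i _; rewrite dot_kernel_norm.
Qed.

(* Each e_i is non-zero at some rational point, while at a given point z the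
   bound by B(z, z) leaves only countably many e_i non-zero. *)
Lemma countable_orthonormal_basis : countable [set: I].
Proof.
have [Ae De _] := eP.
have -> : [set: I] = \bigcup_(q in [set q | W (rational_point R q)])
    [set i | complex.Re `|e i (rational_point R q)| ^+ 2 != 0].
  apply/seteqP; split => // i _; have [e0 he _] := Ae i.
  have [q [Wq eq0]] : exists q,
      [set z | W z /\ e i z != 0] (rational_point R q).
    apply: open_rational_point.
      rewrite openE => z [Wz ez0]; apply: filterI; first exact: open_nbhs_nbhs.
      have cz : e i x @[x --> z] --> e i z := holomorphic_continuous he Wz.
      exact: cvgr_neq0 cz ez0.
    (* Without a point of [W] where [e i] is non-zero, [e i] vanishes everywhere, its values off [W]
       being 0 already. This contradicts its unit norm. *)
    apply: contrapT => nz; have ei0 z : e i z = 0.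
      apply/eqP; apply: contrapT => /negP ez0; apply: nz; exists z; split => //.
      by apply: contrapT => /e0 eiz; rewrite eiz eqxx in ez0.
    have : complex.Re (dotA2 W (e i) (e i)) = 1 by rewrite De eqxx.
    rewrite Re_dotA2xx /Rintegral integral0_eq => [/esym/eqP|z _].
      by rewrite /= oner_eq0.
    by rewrite ei0 normr0 expr0n.
  exists q => //=; rewrite cplx_sqr_norm; apply: contra eq0.
  rewrite paddr_eq0 ?sqr_ge0// !sqrf_eq0 => /andP[/eqP r0 /eqP i0].
  by apply/eqP/cplx_eqP.
apply: bigcup_countable => [|q Wq]; first exact: countableP.
(* The bound on the finite sums is Bessel's inequality for [K] at the rational point. *)
apply: (@countable_support_bounded_sums _ _ _
  (complex.Re (B (rational_point R q) (rational_point R q)))).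
  by move=> i; exact: sqr_ge0.
move=> s us; rewrite kernel_diag//.
under eq_bigr do rewrite -dot_kernel_norm//.
by apply: A2_bessel => //; exact: A2_K.
Qed.

End parseval.

(** * The trace formula *)

Theorem mainTheorem6 (R : realType) (n : nat)
    (Omega U : set 'rV[cplx R]_n)
    (domainOmega : is_domain Omega)
    (A2Omega_neq0 : A2 Omega <> [set (fun=> 0)])
    (openU : open U) (U_neq0 : U !=set0) (subU : U `<=` Omega)
    (adjR : ('rV[cplx R]_n -> cplx R) -> ('rV[cplx R]_n -> cplx R))
    (adjRP : is_adjoint Omega U (restriction U) adjR)
    (B : 'rV[cplx R]_n -> 'rV[cplx R]_n -> cplx R)
    (BP : is_bergman_kernel Omega B)
    (I : choiceType) (e : I -> 'rV[cplx R]_n -> cplx R)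
    (eP : is_orthonormal_basis Omega e) :
  trace Omega e (adjR \o restriction U) =
  (\int[@lebesgue_cspace R n]_(z in U) (complex.Re (B z z))%:E)%E.
Proof.
have [oO _ _] := domainOmega; have [Ae _ _] := eP.
have Ar i : A2 U (restriction U (e i)) := A2_restriction oO openU subU (Ae i).
have [A2adj adjE] := adjRP.
have traceE i :
    (complex.Re (dotA2 Omega ((adjR \o restriction U) (e i)) (e i)))%:E =
    (\int[@lebesgue_cspace R n]_(z in U) (complex.Re `|e i z| ^+ 2)%:E)%E.
  (* [is_adjoint] has the adjoint in the second slot, so the arguments are swapped first, at the
     price of a conjugation that the real part does not see. *)
  rewrite (dotA2C oO (Ae i) (A2adj _ (Ar i))) cplx_ReJ -adjE//.
  rewrite (EFin_Re_dotA2xx openU (Ar i)).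
  by apply: eq_integral => z Uz; rewrite /restriction patchE Uz.
rewrite /trace (eq_esum (fun i _ => traceE i)) -integral_esum.
- apply: eq_integral => z /set_mem/subU Oz.
  by rewrite (esum_sqr_norm_basis oO eP BP Oz).
- exact: countable_orthonormal_basis oO eP _ BP.
- exact: measurable_open_cspace.
- move=> i; apply: (measurable_funS (measurable_open_cspace oO) subU).
  exact: measurable_int (A2_integrable_sqr oO (Ae i)).
- by move=> i z; rewrite lee_fin sqr_ge0.
Qed.
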